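(* For all $d\ge1$ and $1\le l\le d$, the polynomial $B_l(d,t)=\sum_{k=0}^dh_kt^k$ has only real roots and is alternatingly increasing, i.e. $h_0\le h_d\le h_1\le h_{d-1}\le\cdots\le h_{\lfloor\frac{d+1}{2}\rfloor}$.
   Context: A signed permutation of $[d]$ is a pair $(\sigma,\epsilon)$ with $\sigma\in S_d$, $\epsilon\in\{\pm1\}^d$; $B_d$ is the set of these. Set $\sigma_0=0$, $\epsilon_0=1$. The descent number is $\operatorname{des}(\sigma,\epsilon)=|\{i\in\{0,\dots,d-1\}:\epsilon_i\sigma_i>\epsilon_{i+1}\sigma_{i+1}\}|$. For $1\le l\le d$, $B_l(d,t)=\sum t^{\operatorname{des}(\sigma,\epsilon)}$, the sum over $(\sigma,\epsilon)\in B_d$ with $\epsilon_d\sigma_d=d+1-l$.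
   Formalization: Since the last letter is positive, B_l(d,t) has degree exactly d−1, so h_d=0 and the chain as written fails (d=l=1: B=1, h_0=1>h_1=0); the chain is proved with the degree d−1 in place of d: h_0≤h_{d−1}≤h_1≤h_{d−2}≤⋯≤h_{⌊d/2⌋}. *)

(* Defs.v *)
From mathcomp Require Import all_boot all_order all_fingroup all_algebra.
From mathcomp Require Import reals.
From mathcomp Require Import complex.

Set Implicit Arguments.
Unset Strict Implicit.
Unset Printing Implicit Defensive.

Import Order.TTheory GRing.Theory Num.Theory.
Local Open Scope ring_scope.

(* Signed permutations of [d], 0-indexed: [w.1 i] stands for sigma_(i+1) - 1,
   and [w.2 i = true] means that the sign epsilon_(i+1) is -1. *)
Notation sperm d := ('S_d * {ffun 'I_d -> bool})%type.

(* epsilon_i * sigma_i for 0 <= i <= d, with value 0 at i = 0; for i > 0,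
   [unlift ord0 i = Some j] with i = j + 1. *)
Definition sperm_val (d : nat) (w : sperm d) (i : 'I_d.+1) : int :=
  if unlift ord0 i is Some j then (-1) ^+ w.2 j * (w.1 j).+1%:Z else 0.

(* For i : 'I_d, [widen_ord (leqnSn d) i] and [lift ord0 i] are i and i + 1
   in 'I_d.+1. *)
Definition des (d : nat) (w : sperm d) : nat :=
  #|[set i : 'I_d |
      sperm_val w (widen_ord (leqnSn d) i) > sperm_val w (lift ord0 i)]|.

Definition Bpoly (l d : nat) : {poly int} :=
  \sum_(w : sperm d | sperm_val w ord_max == (d.+1 - l)%:Z) 'X^(des w).

Definition real_rooted (p : {poly int}) : Prop :=
  forall (R : realType) (z : R[i]),
    root (map_poly intr p) z -> z \is Num.real.

(* The sequence 0, n, 1, n - 1, 2, ...; its term of index n is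
   floor((n + 1) / 2). *)
Definition alt_index (n j : nat) : nat :=
  if odd j then (n - j./2)%N else j./2.

(* h_0 <= h_n <= h_1 <= h_(n-1) <= ... <= h_(floor((n+1)/2)), where n is the
   degree of p. *)
Definition alternatingly_increasing (p : {poly int}) : Prop :=
  let n := (size p).-1 in
  forall j : nat, (j < n)%N -> p`_(alt_index n j) <= p`_(alt_index n j.+1).

Lemma des_lt (d : nat) (w : sperm d) : 0 < sperm_val w ord_max -> (des w < d)%N.
Proof.
move=> wd; rewrite ltn_neqAle andbC -[X in (_ <= X)%N]card_ord max_card /=.
apply: contraTN wd => /eqP Dw; rewrite -leNgt.
have all_des (i : 'I_d) :
  sperm_val w (lift ord0 i) < sperm_val w (widen_ord (leqnSn d) i).
  have: i \in [set i : 'I_d |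
      sperm_val w (widen_ord (leqnSn d) i) > sperm_val w (lift ord0 i)].
    suff -> : [set i : 'I_d | sperm_val w (widen_ord (leqnSn d) i)
         > sperm_val w (lift ord0 i)] = setT by rewrite inE.
    by apply/eqP; rewrite eqEcard subsetT cardsT card_ord -[X in (X <= _)%N]Dw /=.
  by rewrite inE.
suff val_le0 k (lt_kd : (k < d.+1)%N) : sperm_val w (Ordinal lt_kd) <= 0.
  by have := val_le0 d (ltnSn d); congr (sperm_val w _ <= 0); apply: val_inj.
elim: k lt_kd => [|k IHk] lt_kd.
  have -> : Ordinal lt_kd = ord0 by apply: val_inj.
  by rewrite /sperm_val unlift_none.
have lt_k : (k < d)%N by [].
have := all_des (Ordinal lt_k).
have -> : lift ord0 (Ordinal lt_k) = Ordinal lt_kd by apply: val_inj.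
move/ltW/le_trans; apply.
have lt_k' : (k < d.+1)%N by apply: leqW.
have -> : widen_ord (leqnSn d) (Ordinal lt_k) = Ordinal lt_k' by apply: val_inj.
exact: IHk.
Qed.

(* B_l(d,t) has degree d - 1 for 1 <= l <= d: a signed permutation with
   epsilon_d * sigma_d > 0 cannot have d descents.  So for [Bpoly l d] the chain
   in [alternatingly_increasing] runs over h_0, ..., h_(d-1).  Ending it at the
   vanishing coefficient h_d instead would make it false, e.g. B_1(1,t) = 1. *)
Lemma size_Bpoly (l d : nat) : (1 <= l <= d)%N -> size (Bpoly l d) = d.
Proof.
case: d => [|n] /andP[l1 ld]; first by case: l l1 ld.
have m_gt0 : 0 < (n.+2 - l)%:Z by rewrite ltz_nat subn_gt0 ltnS.
apply/eqP; rewrite eqn_leq; apply/andP; split.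
  apply: (leq_trans (size_sum _ _ _)); apply/bigmax_leqP => w /eqP wm.
  by rewrite size_polyXn des_lt // wm.
rewrite ltnNge; apply/negP => /leq_sizeP/(_ n (leqnn n))/eqP.
rewrite /Bpoly coef_sum; apply/negP/lt0r_neq0.
have lt_m : (n.+1 - l < n.+1)%N by rewrite ltn_subrL l1.
pose m := Ordinal lt_m.
pose w : sperm n.+1 :=
  (lift_perm ord_max m 1%g, [ffun i : 'I_n.+1 => i != ord_max]).
have wS (j : 'I_n.+1) :
    sperm_val w (lift ord0 j) = (-1) ^+ (j != ord_max) * (w.1 j).+1%:Z.
  by rewrite /sperm_val liftK /= ffunE.
have ordmaxE : ord_max = lift ord0 (ord_max : 'I_n.+1) by apply: val_inj.
have w_last : sperm_val w ord_max == (n.+2 - l)%:Z.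
  by rewrite ordmaxE wS eqxx mul1r /= lift_perm_id /= -subSn.
rewrite (bigD1 w) //= ltr_pwDl //; last first.
  by apply: sumr_ge0 => v _; rewrite coefXn ler0n.
suff -> : des w = n by rewrite coefXn eqxx.
apply/eqP; rewrite eqn_leq; apply/andP; split.
  by rewrite -ltnS des_lt // (eqP w_last).
have wneg (j : 'I_n) : sperm_val w (lift ord0 (lift ord_max j))
    = - (bump m j).+1%:Z.
  by rewrite wS eq_sym neq_lift mulN1r /= lift_perm_lift perm1.
rewrite -[X in (X <= _)%N]card_ord -(card_imset _ (@lift_inj _ (ord_max : 'I_n.+1))).
apply/subset_leq_card/subsetP => _ /imsetP[j _ ->]; rewrite inE wneg.
case: j => -[|k] lt_k.
  have -> : widen_ord (leqnSn n.+1) (lift ord_max (Ordinal lt_k)) = ord0.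
    by apply: val_inj; rewrite /= /bump leqNgt lt_k.
  by rewrite [ltRHS]/sperm_val unlift_none oppr_lt0.
have lt_k' : (k < n)%N by apply: ltnW.
have -> : widen_ord (leqnSn n.+1) (lift ord_max (Ordinal lt_k))
  = lift ord0 (lift ord_max (Ordinal lt_k')).
  by apply: val_inj; rewrite /= /bump leqNgt lt_k [(n <= k)%N]leqNgt lt_k'.
rewrite wneg ltrN2 ltz_nat ltnS /bump /= -addnS leq_add //.
by case: (leqP (n.+1 - l) k) => // /leqW ->.
Qed.

(* Main.v *)
(** Let f_v be the sum of t^des over the signed permutations of [d] with last
value v, for v in -d, ..., -1, 1, ..., d.  Deleting the last letter expresses
each f_v for d + 1 as a sum of the polynomials for d, where those whose index
exceeds v carry an extra factor t.

Alternating increase: list all the coefficients of the f_v, ordered by degree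
and then by v.  The recurrence says that the list for d + 1 consists of the sums
of 2d consecutive terms of the list for d, some of them repeated, so by
induction the list is symmetric and unimodal.  For v > 0 the required
inequalities compare terms of this list.

Real roots: the same recurrence yields, for f_v at d and for S = f_d at d,
    f_v at d + 1       = 2t((1 - t) f_v' + d f_v),
    f_(d+1) at d + 1   = 2t(1 - t) S' + (2(d - 1)t + 1 + t) S.
At the roots of f_v (resp. t S), the factor (1 - t) f_v' + d f_v (resp. the
second right-hand side) is a positive multiple of the derivative of f_v (resp.
t S), so its signs alternate there and all its roots are real, simple and
negative. *)
Require Import Defs.
From mathcomp Require Import all_boot all_order all_fingroup all_algebra.
From mathcomp Require Import reals complex polyrcf.
From mathcomp Require Import zify ring.

Set Implicit Arguments.
Unset Strict Implicit.
Unset Printing Implicit Defensive.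

Import Order.TTheory GRing.Theory Num.Theory.

(** * Signed permutations with a prescribed last value, and the recurrence in [d] *)

Section LastValue.
Local Open Scope ring_scope.

Definition Bval (d : nat) (v : int) : {poly int} :=
  \sum_(w : sperm d | sperm_val w ord_max == v) 'X^(des w).

(** The sign-preserving relabelling that frees the absolute value [m + 1] for a new last letter. *)
Definition bumpz (m : nat) (x : int) : int :=
  match x with
  | Posz 0 => 0
  | Posz n.+1 => (bump m n).+1%:Z
  | Negz n => Negz (bump m n)
  end.

Lemma bumpz_lt (m : nat) (x y : int) : (bumpz m x < bumpz m y) = (x < y).
Proof.
by case: x => [[|n]|n]; case: y => [[|k]|k]; rewrite /bumpz /bump; lia.
Qed.

Definition signedz (b : bool) (n : nat) : int := (-1) ^+ b * n.+1%:Z.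

Lemma bumpz_signedz (m n : nat) (b : bool) :
  bumpz m (signedz b n) = signedz b (bump m n).
Proof. by case: b; rewrite /signedz ?expr1 ?expr0 ?mulN1r ?mul1r. Qed.

Lemma sperm_val_lift (d : nat) (w : sperm d) (j : 'I_d) :
  sperm_val w (lift ord0 j) = signedz (w.2 j) (w.1 j).
Proof. by rewrite /sperm_val liftK. Qed.

Lemma sperm_val0 (d : nat) (w : sperm d) : sperm_val w ord0 = 0.
Proof. by rewrite /sperm_val unlift_none. Qed.

Lemma ord_max_lift (d : nat) : ord_max = lift ord0 (ord_max : 'I_d.+1).
Proof. exact: val_inj. Qed.

Lemma signedz_inj (b b' : bool) (m n : nat) :
  signedz b m = signedz b' n -> b = b' /\ m = n.
Proof.
by case: b; case: b'; rewrite /signedz ?expr1 ?expr0 ?mulN1r ?mul1r; lia.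
Qed.

Lemma des_sum (d : nat) (w : sperm d) :
  des w = (\sum_(i < d) (sperm_val w (lift ord0 i) <
                         sperm_val w (widen_ord (leqnSn d) i))%R)%N.
Proof. by rewrite /des cardsE -sum1_card big_mkcond. Qed.

(** Appends a last letter of absolute value [m + 1], negative when [b] holds, and relabels the
    letters of [w]: the inverse of deleting the last letter. *)
Definition spermS (d : nat) (m : 'I_d.+1) (b : bool) (w : sperm d) : sperm d.+1 :=
  (lift_perm ord_max m w.1,
   [ffun i => if unlift ord_max i is Some j then w.2 j else b]).

Lemma spermS_last (d : nat) (m : 'I_d.+1) (b : bool) (w : sperm d) :
  sperm_val (spermS m b w) ord_max = signedz b m.
Proof.
by rewrite ord_max_lift sperm_val_lift /= lift_perm_id ffunE unlift_none.
Qed.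

Lemma spermS_val (d : nat) (m : 'I_d.+1) (b : bool) (w : sperm d) (i : 'I_d.+1) :
  sperm_val (spermS m b w) (widen_ord (leqnSn d.+1) i) = bumpz m (sperm_val w i).
Proof.
case: (unliftP ord0 i) => [j|] ->.
  have -> : widen_ord (leqnSn d.+1) (lift ord0 j) = lift ord0 (lift ord_max j).
    by apply: val_inj; rewrite /= !/bump /= leqNgt ltn_ord.
  by rewrite !sperm_val_lift /= lift_perm_lift ffunE liftK bumpz_signedz.
have -> : widen_ord (leqnSn d.+1) ord0 = ord0 by apply: val_inj.
by rewrite !sperm_val0.
Qed.

Lemma spermS_inj (d : nat) (m : 'I_d.+1) (b : bool) : injective (spermS m b).
Proof.
move=> [s e] [s' e'] /= [Es Ee]; congr pair.
  apply/permP => j; apply: (@lift_inj _ m).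
  by rewrite -!(lift_perm_lift ord_max) Es.
apply/ffunP => j; move/ffunP/(_ (lift ord_max j)): Ee.
by rewrite !ffunE liftK.
Qed.

Lemma spermS_surj (d : nat) (m : 'I_d.+1) (b : bool) (w : sperm d.+1) :
  sperm_val w ord_max = signedz b m -> exists w0, w = spermS m b w0.
Proof.
case: w => s e; rewrite ord_max_lift sperm_val_lift /=.
move=> /signedz_inj[wb /val_inj wm].
have neq_m j : m != s (lift ord_max j).
  by rewrite -wm (inj_eq perm_inj) neq_lift.
(* The word without its last letter, with the gap left at the value [m] closed. *)
pose f j := s2val (unlift_some (neq_m j)).
have fE j : lift m (f j) = s (lift ord_max j).
  by rewrite /f; case: unlift_some.
have f_inj : injective f.
  by move=> j k /(congr1 (lift m)); rewrite !fE => /perm_inj/lift_inj.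
exists (perm f_inj, [ffun j => e (lift ord_max j)]).
congr pair.
  apply/permP => i; case: (unliftP ord_max i) => [j|] ->.
    by rewrite lift_perm_lift permE fE.
  by rewrite lift_perm_id.
apply/ffunP => i; rewrite !ffunE; case: unliftP => [j|] -> //.
by rewrite ffunE.
Qed.

(** The relabelling is strictly increasing and fixes 0, so the old descents persist and only the
    last position can add one. *)
Lemma des_spermS (d : nat) (m : 'I_d.+1) (b : bool) (w : sperm d) :
  des (spermS m b w) =
  (des w + (signedz b m < bumpz m (sperm_val w ord_max))%R)%N.
Proof.
rewrite !des_sum big_ord_recr /=; congr (_ + _)%N; last first.
  by rewrite -ord_max_lift spermS_last spermS_val.
apply: eq_bigr => i _; rewrite spermS_val.
have -> : lift ord0 (widen_ord (leqnSn d) i) = widen_ord (leqnSn d.+1) (lift ord0 i).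
  exact: val_inj.
by rewrite spermS_val bumpz_lt.
Qed.

Lemma BvalS (d : nat) (m : 'I_d.+1) (b : bool) :
  Bval d.+1 (signedz b m) =
  \sum_(w : sperm d)
    'X^((signedz b m < bumpz m (sperm_val w ord_max))%R : nat) * 'X^(des w).
Proof.
rewrite /Bval.
rewrite (eq_bigl (fun w => w \in [set spermS m b w0 | w0 : sperm d])); last first.
  move=> w; apply/eqP/imsetP => [/spermS_surj[w0 ->]|[w0 _ ->]].
    by exists w0.
  exact: spermS_last.
rewrite big_imset /=; last by move=> w w' _ _; apply: spermS_inj.
by apply: eq_bigr => w _; rewrite des_spermS exprD mulrC.
Qed.

(* The nonzero integers of absolute value at most [d], listed increasingly. *)
Definition rank_val (d r : nat) : int :=
  if (r < d)%N then r%:Z - d%:Z else r.+1%:Z - d%:Z.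

Definition Brank (d r : nat) : {poly int} := Bval d (rank_val d r).

Definition last_rank (d : nat) (w : sperm d.+1) : nat :=
  if w.2 ord_max then (d - w.1 ord_max)%N else (d.+1 + w.1 ord_max)%N.

Lemma last_rank_lt (d : nat) (w : sperm d.+1) : (last_rank w < d.+1.*2)%N.
Proof.
by rewrite /last_rank; case: ifP => _; have := ltn_ord (w.1 ord_max); lia.
Qed.

Lemma last_rankE (d : nat) (w : sperm d.+1) (r : nat) : (r < d.+1.*2)%N ->
  (last_rank w == r) = (sperm_val w ord_max == rank_val d.+1 r).
Proof.
move=> lt_r; rewrite [in RHS]ord_max_lift sperm_val_lift.
rewrite /last_rank /rank_val /signedz.
have := ltn_ord (w.1 ord_max).
by case: (w.2 ord_max); case: ifP; rewrite ?expr1 ?expr0 ?mulN1r ?mul1r; lia.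
Qed.

(* Among the nonzero integers of absolute value at most [d + 1] other than the
   one of rank [r] and its opposite, the number of those below it. *)
Definition rank_shift (d r : nat) : nat := if (r <= d)%N then r else r.-1.

Lemma rank_val_signedz (d r : nat) : (r < d.*2)%N ->
  rank_val d r = signedz (r < d)%N (if (r < d)%N then d.-1 - r else r - d)%N.
Proof.
move=> lt_r; rewrite /rank_val /signedz.
by case: ltnP => r_d; rewrite ?expr1 ?expr0 ?mulN1r ?mul1r; lia.
Qed.

Lemma signedz_lt (b b' : bool) (m n : nat) :
  (signedz b m < signedz b' n) =
  if b then b' ==> (n < m)%N else ~~ b' && (m < n)%N.
Proof.
by case: b; case: b'; rewrite /signedz ?expr1 ?expr0 ?mulN1r ?mul1r; lia.
Qed.

(** Group by the rank [s] of the previous last letter. Exactly [rank_shift d r] of the relabelled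
    values lie below the new last value, so a final descent occurs when [rank_shift d r <= s]. For
    [d = 0] the previous value would be the conventional 0, which has no rank. *)
Lemma BrankS (d r : nat) : (0 < d)%N -> (r < d.+1.*2)%N ->
  Brank d.+1 r = \sum_(s < d.*2) 'X^(rank_shift d r <= s) * Brank d s.
Proof.
case: d => // d _ lt_r.
have lt_m : ((if r < d.+2 then d.+1 - r else r - d.+2) < d.+2)%N.
  by case: ifP; lia.
rewrite /Brank rank_val_signedz // (BvalS (Ordinal lt_m)) /=.
rewrite (partition_big (fun w => Ordinal (last_rank_lt w)) predT) //=.
apply: eq_bigr => s _; rewrite /Bval big_distrr /=.
apply: eq_big => [w|w /eqP sE]; first by rewrite -val_eqE /= last_rankE.
have /eqP -> : sperm_val w ord_max == rank_val d.+1 s.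
  by rewrite -last_rankE // -sE.
congr ('X^_ * _); congr nat_of_bool.
have lt_s := ltn_ord s.
rewrite rank_val_signedz // bumpz_signedz signedz_lt /bump.
have -> : rank_shift d.+1 r = if (r < d.+2)%N then r else r.-1 by [].
move: (nat_of_ord s) lt_s => {sE lt_m w}s lt_s.
by case: (ltnP r d.+2) => r_d; case: (ltnP s d.+1) => s_d /=; lia.
Qed.

Lemma Bval1 (b : bool) : Bval 1 (signedz b 0) = 'X^b.
Proof.
(* The empty signed permutation gives the only term; its last value is the conventional 0. *)
rewrite (BvalS ord0) (big_pred1 (1%g, [ffun=> false])) /=; last first.
  move=> [s e]; apply/esym/eqP; congr pair; first by apply/permP => -[].
  by apply/ffunP => -[].
have -> : ord_max = ord0 :> 'I_1 by apply: val_inj.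
rewrite sperm_val0 des_sum big_ord0 mulr1.
by congr 'X^_; case: b.
Qed.

Lemma Brank1_0 : Brank 1 0 = 'X. Proof. exact: (Bval1 true). Qed.
Lemma Brank1_1 : Brank 1 1 = 1. Proof. exact: (Bval1 false). Qed.

Lemma Bpoly_rank (l d : nat) : (0 < l <= d)%N -> Bpoly l d = Brank d (d.*2 - l).
Proof.
move=> ld; rewrite /Bpoly /Brank /Bval /rank_val.
apply: eq_bigl => w; congr (_ == _); case: ifP; lia.
Qed.
End LastValue.

(** * Symmetric unimodal sequences and alternating increase *)

Section SymmetricUnimodal.
Local Open Scope ring_scope.

Definition symmetric_unimodal (P : int) (H : int -> int) : Prop :=
  (forall x, H (P - x) = H x) /\ (forall x, x + x + 1 <= P -> H x <= H (x + 1)).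

Lemma symmetric_unimodal_le (P : int) (H : int -> int) (x y : int) :
  symmetric_unimodal P H -> x <= y -> x + y <= P -> H x <= H y.
Proof.
move=> [Hsym Hstep].
have up (n : nat) : (x + n%:Z) *+ 2 <= P + 1 -> H x <= H (x + n%:Z).
  elim: n => [|n IHn] le_n; first by rewrite addr0.
  apply: (le_trans (IHn _)); first by lia.
  have -> : x + n.+1%:Z = x + n%:Z + 1 by lia.
  by apply: Hstep; lia.
move=> le_xy le_P; have [le_y|lt_y] := lerP (y *+ 2) P.
  have -> : y = x + (absz (y - x)%R)%:Z by lia.
  by apply: up; lia.
(* Beyond the centre, [y] is replaced by its reflection [P - y], which is still at least [x]. *)
rewrite -(Hsym y); have -> : P - y = x + (absz (P - y - x)%R)%:Z by lia.
by apply: up; lia.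
Qed.

Definition window_sum (n : nat) (H : int -> int) (x : int) : int :=
  \sum_(i < n) H (x - 1 - i%:Z).

(** Moving the window one step gains [H x] and loses [H (x - n)]; left of the new centre the gain is
    at least the loss. *)
Lemma window_sum_unimodal (n : nat) (P : int) (H : int -> int) :
  symmetric_unimodal P H -> symmetric_unimodal (P + n%:Z + 1) (window_sum n H).
Proof.
move=> HP; have [Hsym _] := HP; split=> x.
  rewrite /window_sum (reindex_inj rev_ord_inj); apply: eq_bigr => i _ /=.
  by rewrite -Hsym; congr H; have := ltn_ord i; lia.
move=> le_x.
have sumE : window_sum n H (x + 1) + H (x - n%:Z) = H x + window_sum n H x.
  have -> : window_sum n H (x + 1) = \sum_(i < n) H (x - i%:Z).
    by apply: eq_bigr => i _; congr H; lia.
  transitivity (\sum_(i < n.+1) H (x - i%:Z)); first by rewrite big_ord_recr.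
  rewrite big_ord_recl /= subr0; congr (_ + _).
  by apply: eq_bigr => i _; congr H; rewrite /bump; lia.
have : H (x - n%:Z) <= H x by apply: (symmetric_unimodal_le HP); lia.
by lia.
Qed.

(** A window of length [n] meets each residue class modulo [n] once; the classes with [m <= s] are
    met one period early. For the period [d.*2] of [Bcoef], one period back is one degree down, that
    is, the factor t in [BrankS]. *)
Lemma window_sum_shift (n m : nat) (H : int -> int) (y : int) : (m <= n)%N ->
  window_sum n H (y + m%:Z) =
  \sum_(s < n) H (if (m <= s)%N then y + s%:Z - n%:Z else y + s%:Z).
Proof.
move=> le_mn; rewrite /window_sum.
rewrite -(big_mkord xpredT (fun i => H (y + m%:Z - 1 - i%:Z))).
rewrite -(big_mkord xpredT
  (fun s => H (if (m <= s)%N then y + s%:Z - n%:Z else y + s%:Z))).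
rewrite !(big_cat_nat (leq0n m) le_mn) /=; congr (_ + _).
  rewrite big_nat_rev; apply: eq_big_nat => i /andP[_ lt_i].
  by rewrite leqNgt lt_i /=; congr H; lia.
rewrite big_nat_rev; apply: eq_big_nat => i /andP[le_i lt_i].
by rewrite le_i; congr H; lia.
Qed.

(* The coefficients of all the [Brank d r] in one sequence, ordered by degree
   and then by rank. *)
Definition Bcoef (d : nat) (x : int) : int :=
  if x is Posz n then (Brank d (n %% d.*2))`_(n %/ d.*2) else 0.

Lemma BcoefE (d k r : nat) : (r < d.*2)%N ->
  Bcoef d (k%:Z * d.*2%:Z + r%:Z) = (Brank d r)`_k.
Proof.
move=> lt_r; rewrite -PoszM -PoszD /= modnMDl divnMDl.
  by rewrite modn_small ?divn_small ?addn0.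
exact: leq_ltn_trans lt_r.
Qed.

Lemma Bcoef_lt0 (d : nat) (x : int) : x < 0 -> Bcoef d x = 0.
Proof. by case: x. Qed.

Lemma Bcoef1 (x : int) : Bcoef 1 x = ((x == 1) || (x == 2))%:R.
Proof.
case: x => [[|[|[|[|n]]]]|n] //=; rewrite ?Brank1_0 ?Brank1_1 ?coefX ?coef1 //.
have -> : (n.+4 %/ 1.*2 = (n %/ 2).+2)%N by lia.
have : (n.+4 %% 1.*2 < 2)%N by lia.
by case: (_ %% _)%N => [|[|//]] _; rewrite ?Brank1_0 ?Brank1_1 ?coefX ?coef1.
Qed.

Lemma rank_shift_le (d r : nat) : (r < d.+1.*2)%N -> (rank_shift d r <= d.*2)%N.
Proof. by rewrite /rank_shift; case: ifP; lia. Qed.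

Lemma BcoefS (d r : nat) (k : int) : (0 < d)%N -> (r < d.+1.*2)%N ->
  Bcoef d.+1 (k * d.+1.*2%:Z + r%:Z) =
  window_sum d.*2 (Bcoef d) (k * d.*2%:Z + (rank_shift d r)%:Z).
Proof.
move=> d_gt0 lt_r; rewrite window_sum_shift ?rank_shift_le //.
(* For negative [k] all indices involved are negative and both sides vanish. *)
have [k_lt0|] := ltrP k 0.
  rewrite Bcoef_lt0 ?big1 //; last by nia.
  by move=> s _; rewrite Bcoef_lt0 //; have := ltn_ord s; case: ifP; nia.
case: k => // k _; rewrite BcoefE // BrankS // coef_sum; apply: eq_bigr => s _.
case: leqP => _; last by rewrite expr0 mul1r BcoefE.
rewrite expr1 coefXM; case: k => [|k] /=.
  (* The factor t kills the constant term, in agreement with the value 0 at negative indices. *)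
  by rewrite Bcoef_lt0 //; have := ltn_ord s; lia.
rewrite -BcoefE //; congr Bcoef; lia.
Qed.

(** The reflection sends degree [k] and rank [r] to [d - k] and [2d - 1 - r], the effect of changing
    all signs. By [BcoefS] the new sequence runs through the window sums of the old one, with
    repetitions placed symmetrically. *)
Lemma Bcoef_unimodal (d : nat) : (0 < d)%N ->
  symmetric_unimodal ((d.*2 * d.+1)%N%:Z - 1) (Bcoef d).
Proof.
case: d => // d _; elim: d => [|d IHd].
  split=> x; rewrite !Bcoef1; first by congr (nat_of_bool _)%:R; lia.
  by case: eqP; case: eqP; case: eqP; case: eqP; lia.
have := window_sum_unimodal d.+1.*2 IHd.
set D := d.+1 in IHd *; set W := window_sum _ _.
have -> : (D.*2 * D.+1)%N%:Z - 1 + D.*2%:Z + 1 = D%:Z * 2 * (D%:Z + 2) by lia.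
move=> [Wsym Wstep].
have decomp (x : int) : exists (k : int) (r : nat),
    (r < D.+1.*2)%N /\ x = k * D.+1.*2%:Z + r%:Z.
  exists (x %/ D.+1.*2%:Z)%Z, (absz (x %% D.+1.*2%:Z)%Z).
  have r_ge0 : 0 <= (x %% D.+1.*2%:Z)%Z by apply: modz_ge0.
  have r_lt : (x %% D.+1.*2%:Z)%Z < D.+1.*2%:Z by apply: ltz_pmod.
  by split; [lia | rewrite gez0_abs // -divz_eq].
have CS k r := @BcoefS D r k isT.
split=> x; have [k [r [lt_r ->]]] := decomp x.
  have -> : (D.+1.*2 * D.+2)%N%:Z - 1 - (k * D.+1.*2%:Z + r%:Z) =
            (D%:Z + 1 - k) * D.+1.*2%:Z + (D.+1.*2.-1 - r)%N%:Z by lia.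
  rewrite !CS; [|lia|lia]; rewrite -/W -[RHS]Wsym; congr W.
  have -> : (rank_shift D (D.+1.*2.-1 - r))%:Z = D.*2%:Z - (rank_shift D r)%:Z.
    by rewrite /rank_shift; case: leqP => r1; case: leqP => r2; lia.
  by lia.
(* The last window for degree [k] is also the first one for degree [k + 1]. *)
move=> le_x; have [r_max|r_max] := eqVneq r D.*2.+1.
  have -> : k * D.+1.*2%:Z + r%:Z + 1 = (k + 1) * D.+1.*2%:Z + 0%N%:Z by lia.
  rewrite !CS // r_max le_eqVlt; apply/orP; left; apply/eqP; congr window_sum.
  by rewrite /rank_shift; case: leqP => r1; case: leqP => r2; lia.
have -> : k * D.+1.*2%:Z + r%:Z + 1 = k * D.+1.*2%:Z + r.+1%:Z by lia.
rewrite !CS; [|lia|lia]; rewrite -/W.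
(* Ranks [D] and [D + 1] share a window; otherwise the window moves by one. *)
have [->//|[sE le_s]] : rank_shift D r.+1 = rank_shift D r \/
    rank_shift D r.+1 = (rank_shift D r).+1 /\
    (rank_shift D r < D.*2)%N && ((r <= D)%N ==> (rank_shift D r < D)%N).
  rewrite /rank_shift; case: (ltngtP r D) => [r_D|r_D|->].
  - by right; split=> //; rewrite r_D; lia.
  - by right; split=> //; lia.
  by left.
have -> : k * D.*2%:Z + (rank_shift D r.+1)%:Z =
          k * D.*2%:Z + (rank_shift D r)%:Z + 1 by lia.
apply: Wstep.
(* Either all windows for degree [k] lie in the left half, or the centre halves this block; then
   [r <= D], and the bound [rank_shift D r < D] applies. *)
have [q_le|q_gt] := lerP (k * 2 + 2) (D%:Z + 2).
  by nia.
have kE : k * 2 + 1 = D%:Z + 2 by nia.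
by nia.
Qed.

(** For odd [j], reflecting the left-hand coefficient puts it at rank [2d - 1 - r] in the degree of
    the right-hand one, hence not after rank [r], as [d <= r]. For even [j] the two positions
    already have a sum below the symmetry constant. *)
Lemma Brank_alternating (d r : nat) : (0 < d)%N -> (d <= r < d.*2)%N ->
  size (Brank d r) = d -> alternatingly_increasing (Brank d r).
Proof.
move=> d_gt0 /andP[le_r lt_r] size_B.
rewrite /alternatingly_increasing size_B => j lt_j.
have Bu := Bcoef_unimodal d_gt0; have [Bsym _] := Bu.
rewrite /alt_index /= uphalf_half; case: (boolP (odd j)) => odd_j /=.
  by rewrite -!BcoefE // -Bsym; apply: (symmetric_unimodal_le Bu); nia.
by rewrite -!BcoefE //; apply: (symmetric_unimodal_le Bu); nia.
Qed.
End SymmetricUnimodal.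

(** * Sign alternation at the roots of a split polynomial, and interlacing *)

Section Interlacing.
Local Open Scope ring_scope.

Definition lin_prod (R : rcfType) (s : seq R) : {poly R} :=
  \prod_(r <- s) ('X - r%:P).

Lemma lin_prod_cons (R : rcfType) (x : R) (s : seq R) :
  lin_prod (x :: s) = ('X - x%:P) * lin_prod s.
Proof. exact: big_cons. Qed.

Lemma deriv_lin_prod_cons (R : rcfType) (x y : R) (s : seq R) :
  (lin_prod (x :: s))^`().[y] =
  (lin_prod s).[y] + (y - x) * (lin_prod s)^`().[y].
Proof. by rewrite lin_prod_cons derivM derivXsubC !hornerE. Qed.

Lemma root_lin_prod (R : rcfType) (s : seq R) (x : R) :
  x \in s -> (lin_prod s).[x] = 0.
Proof. by rewrite -root_prod_XsubC => /rootP. Qed.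

(** Left of all its roots, a monic split polynomial has a sign that depends only on the parity of
    its degree. *)
Lemma lin_prod_left_sign (R : rcfType) (x y : R) (s t : seq R) :
    size s = size t -> all (> x) s -> all (> y) t ->
  0 < (lin_prod s).[x] * (lin_prod t).[y].
Proof.
elim: s t => [|a s IHs] [|b t] //=.
  by rewrite /lin_prod big_nil !hornerE ltr01.
move=> [size_st] /andP[xa xs] /andP[yb yt]; have := IHs t size_st xs yt.
rewrite !lin_prod_cons !hornerM !hornerXsubC => st_gt0.
rewrite mulrACA mulr_gt0 // nmulr_rgt0 subr_lt0 //.
Qed.

(** At the two least roots [x < y] the derivative is explicit, up to the opposite factors [x - y]
    and [y - x]. At every later root, restoring the factor of [x] multiplies the derivative by a
    positive number, so induction applies. *)
Lemma deriv_lin_prod_alternates (R : rcfType) (x : R) (s : seq R) :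
  path <%R x s ->
  path (fun a b => (a < b) &&
    ((lin_prod (x :: s))^`().[a] * (lin_prod (x :: s))^`().[b] < 0)) x s.
Proof.
elim: s x => //= y s IHs x /andP[xy path_s].
have gt_y := order_path_min lt_trans path_s.
rewrite xy /=; apply/andP; split.
  rewrite (deriv_lin_prod_cons x x) (deriv_lin_prod_cons x y) subrr mul0r addr0.
  rewrite (root_lin_prod (mem_head y s)) add0r deriv_lin_prod_cons subrr mul0r addr0.
  rewrite lin_prod_cons hornerM hornerXsubC.
  have gt_x : all (> x) s by apply: sub_all gt_y => z; apply: lt_trans.
  have := lin_prod_left_sign erefl gt_x gt_y.
  set u := _.[x]; set v := _.[y] => uv.
  have -> : (x - y) * u * ((y - x) * v) = - ((y - x) ^+ 2 * (u * v)) by ring.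
  by rewrite oppr_lt0 mulr_gt0 // exprn_gt0 // subr_gt0.
apply: sub_in_path (IHs y path_s) => [a b a_s b_s /andP[ab alt]|]; last exact: allss.
have gt_x z : z \in y :: s -> x < z.
  rewrite inE => /predU1P[-> //|z_s].
  by apply: (lt_trans xy); apply: (allP gt_y).
rewrite ab (deriv_lin_prod_cons x a) (deriv_lin_prod_cons x b).
rewrite !root_lin_prod // !add0r mulrACA pmulr_rlt0 //.
by rewrite mulr_gt0 // subr_gt0 gt_x.
Qed.

Lemma alternating_roots (R : rcfType) (q : {poly R}) (x : R) (s : seq R) :
    path (fun a b => (a < b) && (q.[a] * q.[b] < 0)) x s ->
  exists t, [/\ size t = size s, path <%R x t, all (root q) t &
                all (< last x s) t].
Proof.
elim: s x => [|y s IHs] x /=; first by exists [::].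
move=> /andP[/andP[xy alt] path_s].
have [t [size_t path_t root_t lt_t]] := IHs y path_s.
have [z] := poly_ivtoo (ltW xy) alt; rewrite in_itv /= => /andP[xz zy] qz.
have y_last : y <= last y s.
  have lt_s : path <%R y s by apply: sub_path path_s => a b /andP[].
  have := mem_last y s; rewrite inE => /predU1P[->//|].
  by move/(allP (order_path_min lt_trans lt_s))/ltW.
exists (z :: t); rewrite /= size_t xz qz root_t lt_t !andbT; split => //.
  exact: (path_le (@lt_trans _ R) zy).
exact: lt_le_trans y_last.
Qed.

(* The [size s - 1] sign changes of [q] leave a linear cofactor; comparing signs
   at the least element of [s] puts its root strictly below [s]. *)
Lemma interlacing_split (R : rcfType) (s : seq R) (q : {poly R}) :
    sorted <%R s -> size q = (size s).+1 -> 0 < lead_coef q ->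
    {in s, forall r, exists2 k, 0 < k & q.[r] = k * (lin_prod s)^`().[r]} ->
  exists t, [/\ size t = size s, sorted <%R t, all (< last 0 s) t &
                exists2 c, 0 < c & q = c *: lin_prod t].
Proof.
case: s => [|x s] /=.
  move=> _ /eqP/size_poly1P[c c0 ->]; rewrite lead_coefC => c_gt0 _.
  exists [::]; split=> //; exists c => //.
  by rewrite /lin_prod big_nil alg_polyC.
move=> path_s size_q lead_q qE.
have [|t [size_t path_t root_t lt_t]] := @alternating_roots _ q x s.
  apply: sub_in_path (deriv_lin_prod_alternates path_s); last exact: allss.
  move=> a b /qE[k k_gt0 ->] /qE[m m_gt0 ->] /andP[-> alt] /=.
  by rewrite mulrACA pmulr_rlt0 // mulr_gt0.
have gt_s := order_path_min lt_trans path_s.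
have gt_t := order_path_min lt_trans path_t.
have uniq_t : uniq t.
  by apply: (sorted_uniq lt_trans ltxx); apply: path_sorted path_t.
have /dvdpP[u quE] : lin_prod t %| q.
  by apply: uniq_roots_dvdp => //; rewrite uniq_rootsE.
have q_neq0 : q != 0 by rewrite -size_poly_eq0 size_q.
have t_neq0 : lin_prod t != 0.
  by apply: contraNneq q_neq0 => t0; rewrite quE t0 mulr0.
have u_neq0 : u != 0 by apply: contraNneq q_neq0 => u0; rewrite quE u0 mul0r.
have size_u : size u = 2%N.
  have := size_q; rewrite quE size_mul // /lin_prod size_prod_XsubC size_t.
  by rewrite addnS /= -add2n => /addIn.
have [w /factor_theorem[v uE]] := poly2_root size_u.
have v_neq0 : v != 0 by apply: contraNneq u_neq0 => v0; rewrite uE v0 mul0r.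
have /eqP/size_poly1P[c c_neq0 vE] : size v = 1%N.
  by move: size_u; rewrite uE size_mul ?polyXsubC_eq0 // size_XsubC addn2 => -[].
have qE' : q = c *: lin_prod (w :: t).
  by rewrite quE uE vE lin_prod_cons -mulrA mul_polyC.
have c_gt0 : 0 < c.
  move: lead_q; rewrite qE' lead_coefZ (monicP _) ?mulr1 //.
  exact: monic_prod_XsubC.
have wx : w < x.
  have [k k_gt0] := qE x (mem_head _ _).
  rewrite deriv_lin_prod_cons subrr mul0r addr0 qE' hornerZ lin_prod_cons hornerM.
  rewrite hornerXsubC => eq_x; have := lin_prod_left_sign size_t gt_t gt_s.
  rewrite -(pmulr_rgt0 _ k_gt0) mulrCA -eq_x.
  set a := (lin_prod t).[x] in eq_x *.
  have -> : a * (c * ((x - w) * a)) = (x - w) * (c * a ^+ 2) by ring.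
  have [//|xw] := ltrP w x; rewrite ltNge => /negP[].
  by rewrite mulr_le0_ge0 ?subr_le0 // mulr_ge0 ?sqr_ge0 // ltW.
exists (w :: t); split; rewrite /= ?size_t //.
- exact: (path_le (@lt_trans _ R) wx).
- rewrite lt_t andbT; apply: (lt_le_trans wx).
  by have := mem_last x s; rewrite inE => /predU1P[->//|/(allP gt_s)/ltW].
by exists c.
Qed.
End Interlacing.

(** * The recurrence in differential form *)

Section DerivativeRecurrences.
Local Open Scope ring_scope.

Lemma Brank_bottom (d : nat) : (0 < d)%N ->
  Brank d.+1 0 = 'X * \sum_(s < d.*2) Brank d s.
Proof.
move=> d_gt0; rewrite BrankS // big_distrr /=.
by apply: eq_bigr => s _; rewrite expr1.
Qed.

Lemma Brank_top (d : nat) : (0 < d)%N ->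
  Brank d.+1 d.*2.+1 = \sum_(s < d.*2) Brank d s.
Proof.
move=> d_gt0; rewrite BrankS ?doubleS //; apply: eq_bigr => s _.
have -> : rank_shift d d.*2.+1 = d.*2 by rewrite /rank_shift; case: leqP => //; lia.
by rewrite leqNgt ltn_ord /= expr0 mul1r.
Qed.

(** Induction on [d] through [BrankS]. For e = 0 or 1, (1 - t)(t^e)' + t^e = 1, so the right-hand
    side exceeds what the induction hypothesis supplies by 2t times the sum of all polynomials one
    level down. The bottom and top terms of the left-hand sum contribute exactly this. *)
Lemma Brank_deriv (d r : nat) : (0 < d)%N -> (r < d.*2)%N ->
  Brank d.+1 r.+1 =
  2%:R * 'X * ((1 - 'X) * (Brank d r)^`() + d%:R * Brank d r).
Proof.
case: d => // d _; elim: d r => [|d IHd] r lt_r.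
  rewrite BrankS //; last by lia.
  rewrite !big_ord_recl big_ord0 /= Brank1_0 Brank1_1.
  by case: r lt_r => [|[|//]] _; rewrite ?Brank1_0 ?Brank1_1 derivE /=; ring.
have shiftS : rank_shift d.+2 r.+1 = (rank_shift d.+1 r).+1.
  by rewrite /rank_shift ltnS; case: leqP => //; case: r {lt_r}.
rewrite BrankS //; last by lia.
rewrite shiftS big_ord_recl big_ord_recr /= Brank_bottom // expr0 mul1r.
have -> : bump 0 d.*2.+2 = d.+1.*2.+1 by rewrite /bump; lia.
rewrite Brank_top // (_ : _ < _ = true)%N; last first.
  by have := @rank_shift_le d.+1 r lt_r; lia.
rewrite BrankS // raddf_sum /= !big_distrr /= -!big_split /= big_distrr /=.
apply: eq_bigr => s _; rewrite /bump /= add1n ltnS IHd //.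
rewrite derivM -[d.+2]addn1 natrD.
move: (Brank d.+1 s) (Brank d.+1 s)^`() (d.+1%:R) => b b' n.
by case: leqP => _; rewrite ?expr0 ?expr1 derivE; ring.
Qed.

(** In the sum over all ranks, the bottom and top terms are t S and S; [Brank_deriv] rewrites the
    others, whose underlying sum is again S. *)
Lemma Brank_top_deriv (d : nat) : (0 < d)%N ->
  let S := Brank d d.*2.-1 in
  Brank d.+1 d.*2.+1 =
  2%:R * 'X * (1 - 'X) * S^`() + (d.-1.*2%:R * 'X + 1 + 'X) * S.
Proof.
case: d => // -[_|d _ S].
  by rewrite /= Brank_top // !big_ord_recl big_ord0 /= Brank1_0 Brank1_1 derivE double0; ring.
have SE : S = \sum_(s < d.+1.*2) Brank d.+1 s by rewrite -Brank_top.
rewrite Brank_top // big_ord_recl big_ord_recr /= Brank_bottom //.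
have -> : bump 0 d.*2.+2 = d.+1.*2.+1 by rewrite /bump; lia.
rewrite Brank_top // SE raddf_sum /= !big_distrr /= -!big_split /=.
apply: eq_bigr => s _; rewrite /bump /= add1n Brank_deriv //.
have -> : d.+1.*2%:R = d.+1%:R * 2%:R :> {poly int} by rewrite -muln2 natrM.
by move: (Brank d.+1 s) (Brank d.+1 s)^`() (d.+1%:R) => b b' n; ring.
Qed.

End DerivativeRecurrences.

(** * Real-rootedness by induction on [d] *)

Section RealRoots.
Local Open Scope ring_scope.

Lemma size_Brank (d r : nat) : (d <= r < d.*2)%N -> size (Brank d r) = d.
Proof.
move=> dr; have -> : r = (d.*2 - (d.*2 - r))%N by lia.
by rewrite -Bpoly_rank ?size_Bpoly //; lia.
Qed.

Lemma lead_coef_Brank_gt0 (d r : nat) :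
  (d <= r < d.*2)%N -> 0 < lead_coef (Brank d r).
Proof.
move=> dr; rewrite lt_def lead_coef_eq0 -size_poly_eq0 size_Brank //.
apply/andP; split; first by lia.
rewrite lead_coefE /Brank /Bval coef_sum; apply: sumr_ge0 => w _.
by rewrite coefXn ler0n.
Qed.

Definition BrankR (R : rcfType) (d r : nat) : {poly R} := map_poly intr (Brank d r).

Lemma size_BrankR (R : rcfType) (d r : nat) :
  (d <= r < d.*2)%N -> size (BrankR R d r) = d.
Proof. by move=> dr; rewrite size_map_inj_poly ?size_Brank //; apply: intr_inj. Qed.

Lemma lead_coef_BrankR_gt0 (R : rcfType) (d r : nat) :
  (d <= r < d.*2)%N -> 0 < lead_coef (BrankR R d r).
Proof.
move=> dr; rewrite lead_coef_map_inj //; last exact: intr_inj.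
by rewrite ltr0z lead_coef_Brank_gt0.
Qed.

Lemma BrankR_top_split (R : rcfType) (d : nat) :
  exists s : seq R, [/\ size s = d, sorted <%R s, all (< 0) s &
    exists2 c, 0 < c & BrankR R d.+1 d.*2.+1 = c *: lin_prod s].
Proof.
elim: d => [|d [s [size_s sort_s neg_s [c c_gt0 SE]]]].
  exists [::]; split=> //; exists 1 => //.
  by rewrite /BrankR Brank1_1 rmorph1 /lin_prod big_nil scale1r.
(* At [0] and at the roots of [S], the next polynomial has the sign of the
   derivative of [X * S]. *)
pose p := lin_prod (rcons s 0).
have pE : p = lin_prod s * 'X.
  by rewrite /p /lin_prod big_rcons /= subr0.
have QE : BrankR R d.+2 d.+1.*2.+1 =
  2%:R * 'X * (1 - 'X) * (BrankR R d.+1 d.*2.+1)^`() +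
  (d.*2%:R * 'X + 1 + 'X) * BrankR R d.+1 d.*2.+1.
  rewrite /BrankR Brank_top_deriv // deriv_map.
  by rewrite !(rmorphD, rmorphM, rmorphN, rmorph1, rmorph_nat) /= !map_polyX.
have sort_s0 : sorted <%R (rcons s 0).
  by rewrite lt_sorted_pairwise pairwise_rcons neg_s -lt_sorted_pairwise.
have [|||t] := interlacing_split sort_s0 (q := BrankR R d.+2 d.+1.*2.+1).
- by rewrite size_BrankR ?size_rcons ?size_s //; lia.
- by apply: lead_coef_BrankR_gt0; lia.
- move=> r; rewrite mem_rcons inE -/p QE pE SE => /predU1P[->|r_s].
    exists c => //; rewrite derivM derivX !hornerE /=; ring.
  have r0 := root_lin_prod r_s; have r_lt0 := allP neg_s r r_s.
  exists (2%:R * (1 - r) * c).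
    by rewrite !mulr_gt0 // subr_gt0 (lt_trans r_lt0).
  by rewrite derivM derivX derivZ !hornerE /= r0; ring.
(* The largest point of [rcons s 0] is 0, so the new roots are negative. *)
rewrite size_rcons size_s last_rcons => -[size_t sort_t lt_t tE].
by exists t.
Qed.

(** The last value [v + 1] stays fixed. The induction starts at [d = v + 1], where the rank is the
    top one, and [Brank_deriv] raises dimension and rank together. Its factor t contributes the root
    0, hence the weak inequality. *)
Lemma BrankR_split (R : rcfType) (d v : nat) : (v < d)%N ->
  exists s : seq R, [/\ size s = d.-1, sorted <%R s, all (<= 0) s &
    exists2 c, 0 < c & BrankR R d (d + v) = c *: lin_prod s].
Proof.
elim: d => // d IHd; rewrite ltnS leq_eqVlt => /predU1P[->|lt_v].
  have [s [size_s sort_s neg_s [c c_gt0 SE]]] := BrankR_top_split R d.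
  exists s; split=> //; first by apply: sub_all neg_s => x /ltW.
  by exists c => //; rewrite addSn addnn.
have [s [size_s sort_s neg_s [c c_gt0 SE]]] := IHd lt_v.
pose q := (1 - 'X) * (BrankR R d (d + v))^`() + d%:R * BrankR R d (d + v).
have QE : BrankR R d.+1 (d.+1 + v) = 2%:R *: ('X * q).
  rewrite /q /BrankR addSn Brank_deriv ?(leq_ltn_trans _ lt_v) //; last by lia.
  rewrite deriv_map.
  rewrite !(rmorphD, rmorphM, rmorphN, rmorph1, rmorph_nat) /= !map_polyX.
  by rewrite scaler_nat mulr2n -mulrA mulrDl !mul1r.
have dv : (d.+1 <= d.+1 + v < d.+1.*2)%N by lia.
have q_neq0 : q != 0.
  apply/eqP => q0; have := size_BrankR R dv.
  by rewrite QE q0 mulr0 scaler0 size_poly0.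
have size_q : size q = (size s).+1.
  have := size_BrankR R dv; rewrite QE size_scale ?pnatr_eq0 // mulrC size_mulX //.
  by move=> [->]; rewrite size_s prednK // (leq_ltn_trans _ lt_v).
have lead_q : 0 < lead_coef q.
  have := lead_coef_BrankR_gt0 R dv.
  by rewrite QE lead_coefZ lead_coefM lead_coefX mul1r pmulr_rgt0.
have [|t [size_t sort_t lt_t [b b_gt0 tE]]] := interlacing_split sort_s size_q lead_q.
  move=> r r_s; exists ((1 - r) * c).
    by rewrite mulr_gt0 // subr_gt0 (le_lt_trans (allP neg_s r r_s)).
  by rewrite /q SE derivZ !hornerE /= root_lin_prod //; ring.
(* For empty [s] the default value 0 of [last] satisfies the bound as well. *)
have last_le0 : last 0 s <= 0.
  by have := mem_last 0 s; rewrite inE => /predU1P[->//|/(allP neg_s)].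
have neg_t : all (< 0) t by apply: sub_all lt_t => x /lt_le_trans; apply.
exists (rcons t 0); split.
- by rewrite size_rcons size_t size_s; lia.
- by rewrite lt_sorted_pairwise pairwise_rcons neg_t -lt_sorted_pairwise.
- by rewrite all_rcons /= lexx; apply: sub_all neg_t => x /ltW.
exists (2%:R * b); first by rewrite mulr_gt0.
by rewrite QE tE /lin_prod big_rcons /= subr0 -scalerA -scalerAr mulrC.
Qed.

Lemma Brank_real_rooted (d r : nat) : (d <= r < d.*2)%N -> real_rooted (Brank d r).
Proof.
move=> dr R z; have [|s [_ _ _ [c c_gt0 BE]]] := @BrankR_split R d (r - d).
  by lia.
have -> : map_poly intr (Brank d r) = map_poly (real_complex R) (BrankR R d r).
  rewrite /BrankR -map_poly_comp; apply: eq_map_poly => x /=.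
  by rewrite rmorph_int.
rewrite -[r in BrankR R d r](@subnKC d) ?BE; last by lia.
rewrite map_polyZ /= rootZ; last by rewrite fmorph_eq0 gt_eqF.
rewrite /lin_prod rmorph_prod /=.
under eq_bigr do rewrite map_polyXsubC.
rewrite -(big_map (real_complex R) xpredT (fun x => 'X - x%:P)) root_prod_XsubC.
by case/mapP => x _ ->; rewrite complex_real.
Qed.
End RealRoots.

Theorem theorem3p9 (d l : nat) (hd : 1 <= d) (hl : 1 <= l <= d) :
  real_rooted (Bpoly l d) /\ alternatingly_increasing (Bpoly l d).
Proof.
rewrite Bpoly_rank //.
(* The last value [d + 1 - l] is positive, so its rank lies in the upper half. *)
have r_d : d <= d.*2 - l < d.*2 by lia.
split; first exact: Brank_real_rooted.
by apply: Brank_alternating => //; exact: size_Brank.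
Qed.
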